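(* Let $\sim$ be a prelambda congruence. Then $\sim$ is a lambda congruence if and only if it satisfies the following condition of extensionality for abstractions: for all terms $A, B$ and all variables $x, y$, if $[\lambda x A]D \sim [\lambda y B]D$ for every term $D$, then $\lambda x A \sim \lambda y B$.
   Context: Let $\mathbb{V}$ be an infinite set whose elements are called variables. The set $\mathbb{T}$ of terms is the set of words inductively defined by: every variable $x$ is a term; if $A,B$ are terms then $[AB]$ is a term; if $x$ is a variable and $A$ a term then $[\lambda x A]$ is a term. Equality of terms is syntactic identity. We abbreviate $[AB]$ as $AB$ and $[\lambda x A]$ as $\lambda x A$. A binary relation $\sim$ on $\mathbb{T}$ is a congruence if it is reflexive, symmetric, transitive, and for all terms $A,B,C,D$ and every variable $x$: $A\sim B$ implies $\lambda x A \sim \lambda x B$, and $A\sim B$, $C \sim D$ imply $AC \sim BD$. A prelambda congruence is a congruence $\sim$ such that for all terms $A,B,D$ and all variables $x,y$: ($\beta_1$) $[\lambda x x]D \sim D$; ($\beta_2$) $[\lambda x y]D \sim y$ whenever $x\neq y$; ($\beta_3$) $[\lambda x[AB]]D \sim [[\lambda x A]D][[\lambda x B]D]$; ($\beta_4$) $[\lambda x[\lambda x A]]D \sim \lambda x A$; ($\beta_5$) if $x \neq y$ and $[\lambda y D]x \sim D$, then $[\lambda x[\lambda y A]]D \sim \lambda y[[\lambda x A]D]$. A lambda congruence is a prelambda congruence $\sim$ satisfying ($\alpha_e$): for every term $A$ and all variables $x,y$, if $[\lambda y A]x \sim A$ then $\lambda x A \sim \lambda y[[\lambda x A]y]$. 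*)

(* Defs.v *)
From Stdlib Require Import RelationClasses FinFun.

(* Distinct derivations give distinct words (unique readability), so syntactic
   identity of words is Leibniz equality on this type; in particular terms are
   not identified up to renaming of bound variables. *)
Inductive term (V : Type) : Type :=
| Var (x : V)
| App (A B : term V)
| Lam (x : V) (A : term V).

Arguments Var {V} x.
Arguments App {V} A B.
Arguments Lam {V} x A.

Record congruence {V : Type} (R : term V -> term V -> Prop) : Prop := {
  cong_equiv : Equivalence R;
  cong_lam : forall (A B : term V) (x : V), R A B -> R (Lam x A) (Lam x B);
  cong_app : forall A B C D : term V,
    R A B -> R C D -> R (App A C) (App B D)
}.

Record prelambda_congruence {V : Type} (R : term V -> term V -> Prop) : Prop := {
  prelambda_cong : congruence R;
  beta1 : forall (D : term V) (x : V), R (App (Lam x (Var x)) D) D;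
  beta2 : forall (D : term V) (x y : V),
    x <> y -> R (App (Lam x (Var y)) D) (Var y);
  beta3 : forall (A B D : term V) (x : V),
    R (App (Lam x (App A B)) D) (App (App (Lam x A) D) (App (Lam x B) D));
  beta4 : forall (A D : term V) (x : V),
    R (App (Lam x (Lam x A)) D) (Lam x A);
  beta5 : forall (A D : term V) (x y : V),
    x <> y -> R (App (Lam y D) (Var x)) D ->
    R (App (Lam x (Lam y A)) D) (Lam y (App (Lam x A) D))
}.

Record lambda_congruence {V : Type} (R : term V -> term V -> Prop) : Prop := {
  lambda_prelambda : prelambda_congruence R;
  alpha_e : forall (A : term V) (x y : V),
    R (App (Lam y A) (Var x)) A ->
    R (Lam x A) (Lam y (App (Lam x A) (Var y)))
}.

Definition abstraction_extensional {V : Type}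
    (R : term V -> term V -> Prop) : Prop :=
  forall (A B : term V) (x y : V),
    (forall D : term V, R (App (Lam x A) D) (App (Lam y B) D)) ->
    R (Lam x A) (Lam y B).

(* Main.v *)
Require Import Defs.
From Stdlib Require Import FinFun.
From Stdlib Require Import List Classical RelationClasses Setoid Morphisms.
Import ListNotations.

(** In a prelambda congruence, [[λzA]v ~ A] for a single variable [v <> z]
    already gives [[λzA]D ~ A] for every term [D]: substitute [D] for [z] on
    both sides of the hypothesis and use (β3), (β4) and (β2).  Hence [A] does
    not depend on any variable [z] which does not occur in it, whatever [D]
    binds.

    Under (α_e), two abstractions can thus be rewritten with the same fresh
    bound variable [z], and extensionality is only needed at [D = z].
    Conversely, if [[λyA]x ~ A] with [x <> y], then [[λy[λxA]]D ~ λxA] for all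
    [D], by (β5) at one fresh variable; so [λxA] and [λy[[λxA]y]] agree on
    every [D]. *)

Fixpoint term_vars {V : Type} (A : term V) : list V :=
  match A with
  | Var x => [x]
  | App A B => term_vars A ++ term_vars B
  | Lam x A => x :: term_vars A
  end.

Lemma exists_fresh {V : Type} (V_infinite : ~ Finite V) (l : list V) :
  exists z, ~ In z l.
Proof.
  apply not_all_ex_not. intros H. apply V_infinite. now exists l.
Qed.

Section Prelambda.

Context {V : Type} {R : term V -> term V -> Prop}.
Hypothesis R_prelambda : prelambda_congruence R.

#[local] Instance prelambda_Equivalence : Equivalence R :=
  cong_equiv R (prelambda_cong R R_prelambda).

#[local] Instance App_Proper : Proper (R ==> R ==> R) App.
Proof.
  intros A B HAB C D HCD.
  now apply (cong_app R (prelambda_cong R R_prelambda)).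
Qed.

#[local] Instance Lam_Proper : Proper (eq ==> R ==> R) Lam.
Proof.
  intros x ? <- A B HAB. now apply (cong_lam R (prelambda_cong R R_prelambda)).
Qed.

Lemma indep_at_term (A D : term V) (z v : V) :
  v <> z -> R (App (Lam z A) (Var v)) A -> R (App (Lam z A) D) A.
Proof.
  intros Hvz HA. rewrite <- HA at 1.
  rewrite (beta3 R R_prelambda), (beta4 R R_prelambda).
  rewrite (beta2 R R_prelambda) by congruence.
  exact HA.
Qed.

(** By induction on [A]. As [v] differs from every binder in [A], the side condition of (β5) is
    always an instance of (β2). *)
Lemma Lam_fresh_at_fresh (A : term V) (z v : V) :
  ~ In z (term_vars A) -> ~ In v (term_vars A) ->
  R (App (Lam z A) (Var v)) A.
Proof.
  induction A as [x | A IHA B IHB | x A IHA]; simpl; intros Hz Hv.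
  - apply (beta2 R R_prelambda). intuition congruence.
  - rewrite in_app_iff in Hz, Hv.
    rewrite (beta3 R R_prelambda), IHA, IHB by tauto. reflexivity.
  - rewrite (beta5 R R_prelambda).
    + rewrite IHA by tauto. reflexivity.
    + intuition congruence.
    + apply (beta2 R R_prelambda). tauto.
Qed.

Hypothesis V_infinite : ~ Finite V.

Lemma Lam_fresh (A D : term V) (z : V) :
  ~ In z (term_vars A) -> R (App (Lam z A) D) A.
Proof.
  intros Hz.
  destruct (exists_fresh V_infinite (z :: term_vars A)) as [v Hv].
  simpl in Hv. apply indep_at_term with (v := v).
  - intuition congruence.
  - apply Lam_fresh_at_fresh; tauto.
Qed.

Lemma indep_Lam (A D : term V) (x y : V) :
  x <> y -> R (App (Lam y A) (Var x)) A ->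
  R (App (Lam y (Lam x A)) D) (Lam x A).
Proof.
  intros Hxy HA.
  (* [v <> x] gives the side condition of (β5), and [v <> y] allows [indep_at_term]. *)
  destruct (exists_fresh V_infinite [x; y]) as [v Hv]. simpl in Hv.
  apply indep_at_term with (v := v); [intuition congruence |].
  rewrite (beta5 R R_prelambda).
  - rewrite (indep_at_term A (Var v) y x Hxy HA). reflexivity.
  - congruence.
  - apply (beta2 R R_prelambda). tauto.
Qed.

Lemma lambda_abstraction_extensional :
  lambda_congruence R -> abstraction_extensional R.
Proof.
  intros HR A B x y HAB.
  destruct (exists_fresh V_infinite (term_vars A ++ term_vars B)) as [z Hz].
  rewrite in_app_iff in Hz.
  (* [z] may equal [x] or [y]: (α_e) only asks that the bodies not depend on [z]. *)
  rewrite (alpha_e R HR A x z) by (apply Lam_fresh; tauto).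
  rewrite (alpha_e R HR B y z) by (apply Lam_fresh; tauto).
  rewrite HAB. reflexivity.
Qed.

Lemma abstraction_extensional_lambda :
  abstraction_extensional R -> lambda_congruence R.
Proof.
  intros Hext. split; [exact R_prelambda |].
  intros A x y HA. apply Hext. intros D.
  (* The right side becomes [App (App (Lam y (Lam x A)) D) D]; it remains to absorb the inner
     [D]. *)
  rewrite (beta3 R R_prelambda), (beta1 R R_prelambda).
  destruct (classic (x = y)) as [<- | Hxy].
  - rewrite (beta4 R R_prelambda). reflexivity.
  - rewrite (indep_Lam A D x y Hxy HA). reflexivity.
Qed.

End Prelambda.

Theorem theorem5p5 (V : Type) (V_infinite : ~ Finite V)
    (R : term V -> term V -> Prop) (R_prelambda : prelambda_congruence R) :
  lambda_congruence R <-> abstraction_extensional R.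
Proof.
  split.
  - exact (lambda_abstraction_extensional R_prelambda V_infinite).
  - exact (abstraction_extensional_lambda R_prelambda V_infinite).
Qed.
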